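(* Let $\beta_{\min},\beta_{\max}>0$, let $(\beta_k)\subset(\beta_{\min},\beta_{\max})$ be a monotone sequence, and let $(x^k,y^k)$ be a sequence generated by the primal-dual algorithm with linesearch with variable $(\beta_k)$ described in the context, applied to $\min_{x\in X}\max_{y\in Y}\langle Kx,y\rangle+g(x)-f^*(y)$. Then $(x^k,y^k)$ is a bounded sequence in $X\times Y$ and all its cluster points are solutions (saddle points) of this problem. Moreover, if the restriction $g|_{\operatorname{dom} g}$ of $g$ to its effective domain is continuous and $(\tau_k)$ is bounded from above, then the whole sequence $(x^k,y^k)$ converges to a solution of the problem.
   Context: Setting: $X,Y$ are finite-dimensional real inner product spaces with norms $\|\cdot\|=\sqrt{\langle\cdot,\cdot\rangle}$; $K\colon X\to Y$ is linear with adjoint $K^*$; $g\colon X\to(-\infty,+\infty]$ and $f^*\colon Y\to(-\infty,+\infty]$ are proper lower semicontinuous convex functions ($f^*$ is the Legendre–Fenchel conjugate of a convex lower semicontinuous function $f$). A solution (saddle point) is a pair $(\hat x,\hat y)\in \operatorname{dom} g\times\operatorname{dom} f^*$ with $g(x)-g(\hat x)+\langle K^*\hat y,x-\hat x\rangle\ge 0$ for all $x\in X$ and $f^*(y)-f^*(\hat y)-\langle K\hat x,y-\hat y\rangle\ge 0$ for all $y\in Y$. It is assumed that a saddle point exists. $\operatorname{prox}_h(x)=\operatorname{argmin}_z\{h(z)+\frac12\|z-x\|^2\}$. PDAL with variable $(\beta_k)$. Initialization: choose $x^0\in X$, $y^1\in Y$, $\tau_0>0$, $\mu\in(0,1)$,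 $\delta\in(0,1)$; set $\theta_0=1$. For $k=1,2,\dots$: 1. $x^k=\operatorname{prox}_{\tau_{k-1}g}(x^{k-1}-\tau_{k-1}K^*y^k)$. 2. Choose any trial value $\tau_k\in[\tau_{k-1},\tau_{k-1}\sqrt{1+\theta_{k-1}}]$ and run the linesearch: 2.a. compute $\theta_k=\tau_k/\tau_{k-1}$, $\bar x^k=x^k+\theta_k(x^k-x^{k-1})$, $y^{k+1}=\operatorname{prox}_{\beta_k\tau_kf^*}(y^k+\beta_k\tau_kK\bar x^k)$; 2.b. if $\sqrt{\beta_k}\,\tau_k\|K^*y^{k+1}-K^*y^k\|\le\delta\|y^{k+1}-y^k\|$, stop the linesearch (keeping the current $\tau_k,\theta_k,\bar x^k,y^{k+1}$); otherwise replace $\tau_k$ by $\mu\tau_k$ and return to 2.a. *)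

(* Defs.v *)
From HB Require Import structures.
From mathcomp Require Import all_boot all_order all_algebra.
From mathcomp Require Import all_classical all_reals all_analysis.
Import Order.TTheory GRing.Theory Num.Theory.
Import numFieldNormedType.Exports.

Set Implicit Arguments.
Unset Strict Implicit.
Unset Printing Implicit Defensive.

Local Open Scope classical_set_scope.
Local Open Scope ring_scope.

(* Finite-dimensional real inner product spaces.  Finite dimension comes from
   the Vector structure; the topology is the one of the norm of the normed
   module, which [norm_dotp] ties to the inner product. *)
HB.mixin Record NormedModule_hasDot (R : realType) T
    & NormedModule R T & Vector R T := {
  dotp : {dot T for (@idfun R)} ;
  norm_dotp : forall x : T, `|x| = Num.sqrt (dotp x x)
}.

#[short(type="euclideanType")]
HB.structure Definition Euclidean (R : realType) :=
  {T of NormedModule R T & Vector R T & NormedModule_hasDot R T}.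

Notation "''[' x , y ]" := (dotp x y) : ring_scope.

Definition is_adjoint (R : realType) (X Y : euclideanType R)
    (K : {linear X -> Y}) (Ks : {linear Y -> X}) :=
  forall (x : X) (y : Y), '[K x, y] = '[x, Ks y].

Section convex_analysis.
Context {R : realType} {X : euclideanType R}.
Implicit Types h : X -> \bar R.
Local Open Scope ereal_scope.

Definition dom h : set X := [set x | h x < +oo].

Definition proper h := (forall x, -oo < h x) /\ dom h !=set0.

Definition econvex h := forall (t : R) (x y : X), (0 < t < 1)%R ->
  h (t *: x + (1 - t) *: y)%R <= t%:E * h x + (1 - t)%:E * h y.

Definition proper_lsc_convex h :=
  [/\ proper h, lower_semicontinuous h & econvex h].

(* Legendre-Fenchel conjugate *)
Definition conjugate h : X -> \bar R :=
  fun y => ereal_sup (range (fun x => ('[x, y])%:E - h x)).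

Definition argmin h : set X := [set x | forall z, h x <= h z].

(* [prox h x] is the set of minimizers; it is a singleton when h is proper,
   lower semicontinuous and convex, so that p = prox_h(x) reads
   [prox h x p]. *)
Definition prox h (x : X) : set X :=
  argmin (fun z => h z + (`|z - x| ^+ 2 / 2)%:E).

End convex_analysis.

Section primal_dual.
Context {R : realType} {X Y : euclideanType R}.
Variables (K : {linear X -> Y}) (Ks : {linear Y -> X}).
Variables (g : X -> \bar R) (fs : Y -> \bar R).

Definition saddle_point (s : X * Y) :=
  [/\ dom g s.1, dom fs s.2,
      forall x, (0 <= g x - g s.1 + ('[Ks s.2, x - s.1])%:E)%E &
      forall y, (0 <= fs y - fs s.2 - ('[K s.1, y - s.2])%:E)%E].

Variables (mu delta : R).

(* One iteration of the linesearch: the data are the step parameter b, the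
   previous step size t', the previous and current primal iterates x' and x,
   and the current dual iterate y. *)
Section linesearch.
Variables (b t' : R) (x' x : X) (y : Y).

(* Step 2.a with the trial value t. *)
Definition trial (t : R) (ynew : Y) :=
  let theta := t / t' in
  let xbar := x + theta *: (x - x') in
  prox (fun z => (b * t)%:E * fs z)%E (y + (b * t) *: K xbar) ynew.

(* The stopping test of step 2.b. *)
Definition accepted (t : R) (ynew : Y) : bool :=
  Num.sqrt b * t * `|Ks ynew - Ks y| <= delta * `|ynew - y|.

(* [linesearch t s ynew]: started from the trial value t, the linesearch stops
   after finitely many trials, returning the step size s and the dual iterate
   ynew. *)
Inductive linesearch (t : R) : R -> Y -> Prop :=
| linesearch_stop ynew :
    trial t ynew -> accepted t ynew -> linesearch t t ynew
| linesearch_backtrack z s ynew :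
    trial t z -> ~~ accepted t z -> linesearch (mu * t) s ynew ->
    linesearch t s ynew.

End linesearch.

(* The run of the algorithm.  Iteration k is written with k.+1 so that k ranges
   over all natural numbers; y 0 and beta 0 are not used. *)
Record pdal (beta : nat -> R) (x : nat -> X) (y : nat -> Y)
    (tau theta : nat -> R) : Prop := {
  pdal_tau0 : 0 < tau 0%N ;
  pdal_mu : 0 < mu < 1 ;
  pdal_delta : 0 < delta < 1 ;
  pdal_theta0 : theta 0%N = 1 ;
  pdal_primal : forall k,
    prox (fun z => (tau k)%:E * g z)%E (x k - tau k *: Ks (y k.+1)) (x k.+1) ;
  pdal_linesearch : forall k, exists t : R,
    tau k <= t <= tau k * Num.sqrt (1 + theta k) /\
    linesearch (beta k.+1) (tau k) (x k) (x k.+1) (y k.+1)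
      t (tau k.+1) (y k.+2) ;
  pdal_theta : forall k, theta k.+1 = tau k.+1 / tau k
}.

End primal_dual.

(* Main.v *)
(** Fix a saddle point (xh, yh) and let P be the nonnegative primal gap
    g z - g xh + <K* yh, z - xh>.  The prox inequalities of three consecutive
    iterates, the acceptance test and Cauchy-Schwarz show that
      A_k + B_k / beta_k, where B_k = |y_k - yh|^2 and
      A_k = |x_k - xh|^2 + 2 tau_{k-1} (1 + theta_{k-1}) P(x_{k-1}),
    decreases, up to the change of beta, by a multiple of the squared increments
    |xbar_k - x_k|^2 + |x_{k+1} - xbar_k|^2 + |y_{k+1} - y_k|^2 / beta_k.
    Since beta is monotone, one of the weight pairs (1, 1 / beta_k), (beta_k, 1)
    is nonincreasing, so a weighted energy is nonincreasing: the iterates are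
    bounded and the increments vanish.  The linesearch keeps tau away from 0, so
    the prox inequalities pass to the limit at a cluster point by lower
    semicontinuity.  Taking (xh, yh) to be a cluster point, continuity of g on
    its domain and boundedness of tau make the energy vanish along a
    subsequence, hence along the whole sequence. *)
Require Import Defs.
From HB Require Import structures.
From mathcomp Require Import all_boot all_order all_algebra.
From mathcomp Require Import all_classical all_reals all_analysis.
From mathcomp Require Import ring lra.
Import Order.TTheory GRing.Theory Num.Theory.
Import numFieldNormedType.Exports.

Set Implicit Arguments.
Unset Strict Implicit.
Unset Printing Implicit Defensive.

Local Open Scope classical_set_scope.
Local Open Scope ring_scope.

Lemma cvg_norm_le (R : realType) (V : normedModType R) (e : nat -> R)
    (u : nat -> V) (l : V) :
  (forall n, `|u n - l| <= e n) -> e @ \oo --> 0 -> u @ \oo --> l.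
Proof.
move=> ue e0; apply/subr_cvg0; apply/norm_cvg0P.
apply: (squeeze_cvgr _ (cvg_cst 0) e0).
by apply: nearW => n; rewrite normr_ge0 ue.
Qed.

(** * Finite-dimensional inner product spaces *)

Section inner_product.
Context {R : realType} {X : euclideanType R}.
Implicit Types u v w : X.

Lemma dotpC u v : '[u, v] = '[v, u].
Proof. by rewrite hermC expr0 mul1r. Qed.

Lemma dotpDl u v w : '[u + v, w] = '[u, w] + '[v, w].
Proof. by rewrite linearDl. Qed.

Lemma dotpDr u v w : '[w, u + v] = '[w, u] + '[w, v].
Proof. by rewrite linearDr. Qed.

Lemma dotpNl u v : '[- u, v] = - '[u, v].
Proof. by rewrite linearNl. Qed.

Lemma dotpNr u v : '[u, - v] = - '[u, v].
Proof. by rewrite linearNr. Qed.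

Lemma dotpZl (a : R) u v : '[a *: u, v] = a * '[u, v].
Proof. by rewrite linearZl_LR. Qed.

Lemma dotpZr (a : R) u v : '[u, a *: v] = a * '[u, v].
Proof. by rewrite linearZr_LR. Qed.

Lemma dotp0l u : '[0, u] = 0.
Proof. by rewrite linear0l. Qed.

Lemma dotp_ge0 u : 0 <= '[u, u].
Proof.
have [->|u0] := eqVneq u 0; first by rewrite dotp0l.
by rewrite ltW// neq0_dnorm_gt0.
Qed.

Lemma sqr_normE u : `|u| ^+ 2 = '[u, u].
Proof. by rewrite norm_dotp sqr_sqrtr// dotp_ge0. Qed.

Definition dotpE := (dotpDl, dotpDr, dotpNl, dotpNr, dotpZl, dotpZr).

Lemma sqr_normD u v : `|u + v| ^+ 2 = `|u| ^+ 2 + 2 * '[u, v] + `|v| ^+ 2.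
Proof. by rewrite !sqr_normE !dotpE (dotpC v u); ring. Qed.

Lemma sqr_normZ (a : R) u : `|a *: u| ^+ 2 = a ^+ 2 * `|u| ^+ 2.
Proof. by rewrite !sqr_normE !dotpE; ring. Qed.

Lemma cosine_rule u v w :
  2 * '[v - u, w - v] = `|u - w| ^+ 2 - `|v - u| ^+ 2 - `|v - w| ^+ 2.
Proof.
rewrite !sqr_normE !dotpE (dotpC v u) (dotpC w u) (dotpC w v); ring.
Qed.

Lemma cauchy_schwarz u v : '[u, v] <= `|u| * `|v|.
Proof.
have [->|v0] := eqVneq v 0.
  by rewrite dotpC dotp0l normr0 mulr0.
have vp : 0 < `|v| by rewrite normr_gt0.
have [->|u0] := eqVneq u 0; first by rewrite dotp0l normr0 mul0r.
have up : 0 < `|u| by rewrite normr_gt0.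
have := dotp_ge0 (`|v| *: u - `|u| *: v).
rewrite !dotpE (dotpC v u) -!sqr_normE => H.
rewrite -(ler_pM2l (mulr_gt0 up vp)); nra.
Qed.

Lemma dotp_norm_le u v : `|'[u, v]| <= `|u| * `|v|.
Proof.
rewrite ler_norml cauchy_schwarz andbT lerNl -dotpNl.
by rewrite (le_trans (cauchy_schwarz _ _))// normrN.
Qed.

Lemma dotp_cvg (u v : nat -> X) a b :
  u @ \oo --> a -> v @ \oo --> b -> '[u n, v n] @[n --> \oo] --> '[a, b].
Proof.
move=> ua vb; apply/subr_cvg0.
have E n : '[u n, v n] - '[a, b] = '[u n - a, v n] + '[a, v n - b].
  by rewrite !dotpE; ring.
apply: (@cvg_norm_le _ _ (fun n => `|u n - a| * `|v n| + `|a| * `|v n - b|)).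
  move=> n; rewrite subr0 E (le_trans (ler_normD _ _))//.
  by rewrite lerD// dotp_norm_le.
have -> : (0 : R) = `|0 : X| * `|b| + `|a| * `|0 : X|.
  by rewrite normr0 mul0r mulr0 addr0.
apply: cvgD; apply: cvgM.
- by apply: cvg_norm; apply/subr_cvg0.
- exact: cvg_norm.
- exact: cvg_cst.
- by apply: cvg_norm; apply/subr_cvg0.
Qed.

End inner_product.

(** * Riesz representation, bounded linear maps and compactness of balls *)

Section finite_dimension.
Context {R : realType}.

(** The map [F] sending w to its inner products with a basis is injective because the inner product
    is definite, hence onto by a dimension count. So some w agrees with [phi] on the basis. *)
Lemma riesz (X : euclideanType R) (phi : {linear X -> R^o}) :
  exists w, forall v, phi v = '[w, v].
Proof.
pose e i : X := (vbasis {:X})`_i.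
pose n := \dim {:X}.
pose F w : 'rV[R]_n := \row_(i < n) '[w, e i].
have Flin : linear F.
  by move=> a u v; apply/rowP => i; rewrite !mxE dotpDl dotpZl.
pose Fl : {linear X -> 'rV[R]_n} :=
  HB.pack F (GRing.isLinear.Build _ _ _ _ F Flin).
have decomp v : v = \sum_i coord (vbasis {:X}) i v *: e i.
  exact/coord_vbasis/memvf.
have Finj : lker (linfun Fl) == 0%VS.
  apply/lker0P => u v; rewrite !lfunE/= => /rowP uv.
  apply/eqP; rewrite -subr_eq0; apply/eqP.
  have uv0 (i : 'I_n) : '[u - v, e i] = 0.
    by have := uv i; rewrite !mxE dotpDl dotpNl => ->; rewrite subrr.
  have : `|u - v| ^+ 2 = 0.
    rewrite sqr_normE {2}[u - v]decomp linear_sumr/= big1// => i _.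
    by rewrite dotpZr uv0 mulr0.
  by move/eqP; rewrite expf_eq0/= normr_eq0 => /eqP.
have Ffull : limg (linfun Fl) = fullv.
  apply/eqP; rewrite eqEdim subvf/=.
  have := limg_ker_dim (linfun Fl) fullv.
  rewrite (eqP Finj) capv0 dimv0 add0n => ->.
  by rewrite [leqLHS]dimvf /dim/= mul1n.
have : \row_(i < n) phi (e i) \in limg (linfun Fl) by rewrite Ffull memvf.
case/memv_imgP => w _; rewrite lfunE/= => /rowP H.
exists w => v; rewrite (decomp v) linear_sum/= linear_sumr/=.
apply: eq_bigr => i _; rewrite linearZ/= dotpZr.
by have := H i; rewrite !mxE => ->.
Qed.

(** Each coordinate functional is an inner product with a fixed vector, so Cauchy-Schwarz bounds it.
    This ties the norm to the coordinates of the vector space structure. *)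
Lemma coord_bounded (X : euclideanType R) :
  exists2 C : R, 0 <= C &
    forall (v : X) i, `|coord (vbasis {:X}) i v| <= C * `|v|.
Proof.
have H i : exists C, forall v : X, `|coord (vbasis {:X}) i v| <= C * `|v|.
  have [w wP] := riesz (coord (vbasis {:X}) i); exists `|w| => v.
  by rewrite wP; exact: dotp_norm_le.
have [C CP] := choice H.
exists (\sum_i `|C i|); first by apply: sumr_ge0.
move=> v i; apply: (le_trans (CP i v)); apply: ler_wpM2r => //.
by rewrite (le_trans (ler_norm _))// (bigD1 i)//= lerDl sumr_ge0.
Qed.

Lemma linear_bounded_dim (X : euclideanType R) (V : normedModType R)
    (f : {linear X -> V}) :
  exists2 L : R, 0 < L & forall v, `|f v| <= L * `|v|.
Proof.
have [C C0 CP] := coord_bounded X.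
pose e i : X := (vbasis {:X})`_i.
have decomp v : v = \sum_i coord (vbasis {:X}) i v *: e i.
  exact/coord_vbasis/memvf.
have S0 : 0 <= C * \sum_(i < \dim {:X}) `|f (e i)|
  by rewrite mulr_ge0// sumr_ge0.
(* Adding 1 keeps the constant positive even for f = 0, so that it may be divided by. *)
exists (C * (\sum_(i < \dim {:X}) `|f (e i)|) + 1); first by rewrite ltr_pwDr.
move=> v; rewrite [in f v](decomp v) linear_sum/=.
rewrite (le_trans (ler_norm_sum _ _ _))//.
apply: (@le_trans _ _ (C * (\sum_(i < \dim {:X}) `|f (e i)|) * `|v|)); last first.
  by rewrite ler_wpM2r// lerDl.
rewrite mulrAC mulr_sumr ler_sum// => i _.
by rewrite linearZ/= normrZ ler_wpM2r.
Qed.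

(** The compact set is the continuous image of a cube of coordinates, large enough by
    [coord_bounded] to reach every vector of norm at most M. *)
Lemma ball_sub_compact (X : euclideanType R) (M : R) :
  exists2 A : set X, compact A & forall v : X, `|v| <= M -> A v.
Proof.
have [C C0 CP] := coord_bounded X.
pose n := \dim {:X}.
pose B : set 'rV[R]_n :=
  [set c | forall i, `[- (C * M), C * M]%classic (c ord0 i)].
have cB : compact B.
  apply: (@rV_compact _ _ (fun=> `[- (C * M), C * M]%classic)) => i.
  exact: segment_compact.
pose r (c : 'rV[R]_n) : X := \sum_(i < n) c 0 i *: (vbasis {:X})`_i.
have cr : continuous r.
  apply: (continuous_big (op := +%R)) => [|i _ c]; first exact: add_continuous.
  apply: (@cvgZr_tmp _ _ _ (nbhs c) _ (fun c => c 0 i)).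
  exact: (@coord_continuous R 1 n 0 i c).
exists (r @` B).
  by apply: continuous_compact => //; exact: continuous_subspaceT.
move=> v vM; exists (\row_i coord (vbasis {:X}) i v); last first.
  rewrite /r [RHS](coord_vbasis (memvf v)).
  by apply: eq_bigr => i _; rewrite mxE.
move=> i /=; rewrite in_itv/= -ler_norml mxE.
by rewrite (le_trans (CP _ _))// ler_wpM2l.
Qed.

Lemma bounded_seq_cluster (X Y : euclideanType R) (x : nat -> X) (y : nat -> Y)
    M :
  (forall k, `|x k| <= M) -> (forall k, `|y k| <= M) ->
  exists s, cluster ((fun k => (x k, y k)) @ \oo) s.
Proof.
move=> xM yM.
have [A cA AP] := ball_sub_compact X M.
have [B cB BP] := ball_sub_compact Y M.
have [|s [_ cs]] := compact_setX cA cB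
    (F := (fun k => (x k, y k)) @ \oo) _; last by exists s.
by exists 0%N => // k _; split => /=; [exact: AP|exact: BP].
Qed.

End finite_dimension.

(** * Proximal points and lower semicontinuity *)

Section extended_real_convex.
Context {R : realType} {X : euclideanType R}.
Implicit Types h : X -> \bar R.

Lemma proper_fineK h z : Defs.proper h -> dom h z -> h z = (fine (h z))%:E.
Proof. by move=> [hN _] hz; rewrite fineK// fin_numE gt_eqF//= lt_eqF. Qed.

Lemma prox_dom h (t : R) x p : Defs.proper h -> 0 < t ->
  prox (fun z => t%:E * h z)%E x p -> dom h p.
Proof.
move=> hp t0 /=; case: (hp) => _ [z hz] /(_ z).
rewrite (proper_fineK hp hz) -EFinM -EFinD /dom/=.
case: (h p) => [r||]//; first by rewrite ltry.
by rewrite gt0_muley ?lte_fin// addye// leye_eq.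
Qed.

(** Variational inequality of the proximal point: compare p with the point at parameter s on the
    segment from p to z, use convexity, divide by s and let s tend to 0. *)
Lemma prox_ineq h (t : R) x p z : Defs.proper h -> econvex h -> 0 < t ->
  prox (fun z => t%:E * h z)%E x p -> dom h z ->
  t * (fine (h p) - fine (h z)) <= '[p - x, z - p].
Proof.
move=> hp hc t0 pp hz; have dp := prox_dom hp t0 pp.
have H s : 0 < s < 1 ->
    t * (fine (h p) - fine (h z)) <= '[p - x, z - p] + s * (`|z - p| ^+ 2).
  move=> /[dup] s01 /andP[s0 s1].
  have cz := hc s z p s01; set w := s *: z + (1 - s) *: p in cz.
  rewrite (proper_fineK hp hz) (proper_fineK hp dp) -!EFinM -EFinD in cz.
  have dw : dom h w by rewrite /dom/= (le_lt_trans cz)// ltry.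
  rewrite (proper_fineK hp dw) lee_fin in cz.
  have wE : w - x = (p - x) + s *: (z - p).
    by rewrite /w scalerBr scalerBl scale1r addrCA addrAC.
  have := pp w; rewrite wE (sqr_normD (p - x)) sqr_normZ dotpZr.
  move: (proper_fineK hp dp) (proper_fineK hp dw) => {1}-> {1}->.
  rewrite -!EFinM -!EFinD lee_fin => Hm.
  rewrite -(ler_pM2l s0).
  have N0 : 0 <= `|z - p| ^+ 2 by exact: exprn_ge0.
  have : t * fine (h w) <= t * (s * fine (h z) + (1 - s) * fine (h p)).
    by rewrite ler_pM2l.
  nra.
apply/ler_addgt0Pr => e e0.
have N1 : 0 < `|z - p| ^+ 2 + 1 by rewrite ltr_wpDl// exprn_ge0.
(* This choice makes the error s |z - p|^2 at most e; the added 1 covers z = p, and 1/2 keeps s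
   below 1. *)
pose s := Num.min (1 / 2) (e / (`|z - p| ^+ 2 + 1)).
have s0 : 0 < s by rewrite lt_min divr_gt0//= divr_gt0.
have s1 : s < 1 by rewrite gt_min; apply/orP; left; lra.
apply: (le_trans (H s _)); first by rewrite s0.
rewrite lerD2l.
have : s * (`|z - p| ^+ 2 + 1) <= e by rewrite -ler_pdivlMr// ge_min lexx orbT.
nra.
Qed.

(** Sequential closedness of the epigraph: a real c strictly between l and h a would eventually
    separate [h (u n)] from [r n]. It also yields finiteness of h at the limit. *)
Lemma lsc_cvg_le h (u : nat -> X) (r : nat -> R) a l : lower_semicontinuous h ->
  u @ \oo --> a -> r @ \oo --> l -> (forall n, h (u n) <= (r n)%:E)%E ->
  (h a <= l%:E)%E.
Proof.
move=> hl ua rl hr; rewrite leNgt; apply/negP => la.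
have [c lc ca] : exists2 c, l < c & (c%:E < h a)%E.
  case: (h a) la => [s||]//.
    rewrite lte_fin => ls; exists ((l + s) / 2); rewrite ?lte_fin; lra.
  by move=> _; exists (l + 1); rewrite ?ltry// ltrDl.
have [V Va Vc] := hl a c ca.
near \oo => n.
have : (c%:E < h (u n))%E by apply: Vc; near: n; exact: ua.
apply/negP; rewrite -leNgt (le_trans (hr n))// lee_fin ltW//.
by near: n; apply: (cvgr_lt l).
Unshelve. all: by end_near. Qed.

End extended_real_convex.

(** * The energy decreases along one iteration *)

Section descent.
Context {R : realType} {X Y : euclideanType R}.
Variables (K : {linear X -> Y}) (Ks : {linear Y -> X}).

(* Sum of theta times the first inequality and theta^2 times the second, since
   x2 - xbar = (x2 - x1) + theta *: (x0 - x1). *)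
Lemma extrapolated_prox_ineq (x0 x1 x2 k : X) (t theta G0 G1 G2 : R) :
  let s := theta * t in
  let xbar := x1 + theta *: (x1 - x0) in
  0 <= theta ->
  t * (G1 - G2) <= '[x1 - (x0 - t *: k), x2 - x1] ->
  t * (G1 - G0) <= '[x1 - (x0 - t *: k), x0 - x1] ->
  s * ((1 + theta) * G1 - G2 - theta * G0) <=
    '[xbar - x1, x2 - xbar] + s * '[k, x2 - xbar].
Proof.
move=> s xbar th0 C1 C2.
have := ler_wpM2l th0 C1; have := ler_wpM2l (mulr_ge0 th0 th0) C2.
have -> : xbar - x1 = theta *: (x1 - x0) by rewrite /xbar addrC addKr.
have -> : x1 - (x0 - t *: k) = (x1 - x0) + t *: k by rewrite opprB addrCA addrC.
have -> : x2 - xbar = (x2 - x1) - theta *: (x1 - x0).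
  by rewrite /xbar opprD addrA.
rewrite -[x0 - x1]opprB /s; move: (x1 - x0) (x2 - x1) => u v.
rewrite !dotpE; lra.
Qed.

(** Sum the primal and dual prox inequalities at the saddle point, the extrapolated inequality and
    the dual gap. By adjointness the bilinear terms cancel up to <K*(y1 - y2), x2 - xbar>, which the
    acceptance test absorbs at the cost of a fraction delta of the squared increments. *)
Lemma descent_step (x0 x1 x2 xh : X) (y1 y2 yh : Y)
    (t theta b delta G0 G1 G2 Gh F2 Fh : R) :
  let s := theta * t in
  let xbar := x1 + theta *: (x1 - x0) in
  let P0 := G0 - Gh + '[Ks yh, x0 - xh] in
  let P1 := G1 - Gh + '[Ks yh, x1 - xh] in
  is_adjoint K Ks ->
  0 <= theta -> 0 < t -> 0 < b -> 0 < delta ->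
  s * (G2 - Gh) <= '[x2 - (x1 - s *: Ks y2), xh - x2] ->
  b * s * (F2 - Fh) <= '[y2 - (y1 + (b * s) *: K xbar), yh - y2] ->
  t * (G1 - G2) <= '[x1 - (x0 - t *: Ks y1), x2 - x1] ->
  t * (G1 - G0) <= '[x1 - (x0 - t *: Ks y1), x0 - x1] ->
  Num.sqrt b * s * `|Ks y2 - Ks y1| <= delta * `|y2 - y1| ->
  0 <= F2 - Fh - '[K xh, y2 - yh] ->
  `|x2 - xh| ^+ 2 + 2 * (s * (1 + theta)) * P1 + `|y2 - yh| ^+ 2 / b +
    (1 - delta) * (`|xbar - x1| ^+ 2 + `|x2 - xbar| ^+ 2 + `|y2 - y1| ^+ 2 / b)
  <= `|x1 - xh| ^+ 2 + 2 * (s * theta) * P0 + `|y1 - yh| ^+ 2 / b.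
Proof.
move=> s xbar P0 P1 adj th0 t0 b0 d0 A B C1 C2 acc D.
have s0 : 0 <= s by rewrite mulr_ge0// ltW.
have C := extrapolated_prox_ineq th0 C1 C2; rewrite -/s -/xbar in C.
have {}A : s * (G2 - Gh) <= '[x2 - x1, xh - x2] + s * '[Ks y2, xh - x2].
  by move: A; rewrite -dotpZl -dotpDl opprB addrCA [X in '[X, _]]addrC.
have {}B : s * (F2 - Fh) <=
    '[y2 - y1, yh - y2] / b - s * '[xbar, Ks yh - Ks y2].
  rewrite -linearB -adj -(ler_pM2l b0) mulrA (le_trans B)//.
  rewrite opprD addrA [X in X <= _]dotpDl dotpNl dotpZl.
  by rewrite le_eqVlt; apply/orP; left; apply/eqP; field; rewrite gt_eqF.
have {}D : s * (F2 - Fh) - s * '[xh, Ks y2 - Ks yh] >= 0.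
  by move: D; rewrite adj linearB -mulrBr => D; exact: mulr_ge0.
have cs : s * '[Ks y1 - Ks y2, x2 - xbar] <=
    delta / 2 * (`|y2 - y1| ^+ 2 / b + `|x2 - xbar| ^+ 2).
  have sb0 : 0 < Num.sqrt b by rewrite sqrtr_gt0.
  have acc' : s * `|Ks y2 - Ks y1| <= delta * (`|y2 - y1| / Num.sqrt b).
    by rewrite mulrA ler_pdivlMr// (le_trans _ acc)// mulrC mulrA.
  (* AM-GM: p q <= (p^2 + q^2) / 2 for p = |y2 - y1| / sqrt b
     and q = |x2 - xbar|. *)
  have := ler_wpM2l s0 (cauchy_schwarz (Ks y1 - Ks y2) (x2 - xbar)).
  rewrite -[Ks y1 - _]opprB normrN => /le_trans; apply.
  have -> : `|y2 - y1| ^+ 2 / b = (`|y2 - y1| / Num.sqrt b) ^+ 2.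
    by rewrite expr_div_n sqr_sqrtr// ltW.
  rewrite mulrA; have := ler_wpM2r (normr_ge0 (x2 - xbar)) acc'.
  move: (_ / Num.sqrt b) `|x2 - xbar| => p q /le_trans; apply.
  have := sqr_ge0 (p - q); nra.
have key : s * ((1 + theta) * P1 - theta * P0) <=
    '[x2 - x1, xh - x2] + '[y2 - y1, yh - y2] / b + '[xbar - x1, x2 - xbar]
    + s * '[Ks y1 - Ks y2, x2 - xbar].
  (* The weights 1 + theta and - theta sum to 1 and combine x1 and x0 into xbar. *)
  have -> : (1 + theta) * P1 - theta * P0 =
      (1 + theta) * G1 - theta * G0 - Gh + '[Ks yh, xbar - xh].
    by rewrite /P1 /P0 /xbar !dotpE; ring.
  clear -A B C D; rewrite (dotpC xbar (_ - _)) in B.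
  rewrite (dotpC xh (_ - _)) in D.
  move: A B C; clearbody s xbar.
  move: '[x2 - x1, _] ('[y2 - y1, _] / b) '[xbar - x1, _] => p q r.
  by move: D; rewrite !dotpE; lra.
(* The two primal expansions contain |x2 - x1|^2 with opposite signs, so it cancels. *)
have := cosine_rule x1 x2 xh; have := cosine_rule y1 y2 yh.
have := cosine_rule x1 xbar x2; move: key cs.
rewrite (distrC x1 x2) (distrC xbar x2).
move: '[Ks y1 - _, _] '[x2 - x1, _] '[y2 - y1, _] '[xbar - x1, _] => q r p o.
move=> key cs e1 e2 e3; have /= e2b := congr1 ( *%R^~ b^-1) e2.
(* Lowers the coefficient of |xbar - x1|^2 from 1 to 1 - delta, the one shared by the other
   increments. *)
have := mulr_ge0 (ltW d0) (sqr_ge0 `|xbar - x1|).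
clearbody P0 P1 s; lra.
Qed.

End descent.

(** * Energies with monotone weights *)

Section weighted_descent.
Context {R : realType}.
Implicit Types A B D p q b : nat -> R.

(** The energy [E] is nonincreasing and lies between c1 (A + B) and c2 (A + B), whence the first
    claim. It converges, and c1 D is at most its decrement, whence the second. *)
Lemma weighted_descent A B D p q (c1 c2 : R) :
  0 < c1 -> (forall n, c1 <= p n <= c2) -> (forall n, c1 <= q n <= c2) ->
  (forall n, p n.+1 <= p n) -> (forall n, q n.+1 <= q n) ->
  (forall n, 0 <= A n) -> (forall n, 0 <= B n) -> (forall n, 0 <= D n) ->
  (forall n, p n * A n.+1 + q n * B n.+1 + c1 * D n <= p n * A n + q n * B n) ->
  (forall m k, (m <= k)%N -> A k + B k <= c2 / c1 * (A m + B m)) /\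
  D @ \oo --> 0.
Proof.
move=> c10 pc qc pd qd A0 B0 D0 H.
pose E n := p n * A n + q n * B n.
have EH n : E n.+1 + c1 * D n <= E n.
  rewrite (le_trans _ (H n))// lerD2r /E lerD//; exact: ler_wpM2r.
have E1 n : c1 * (A n + B n) <= E n.
  rewrite mulrDr /E; have /andP[? _] := pc n; have /andP[? _] := qc n.
  by rewrite lerD// ler_wpM2r.
have E2 n : E n <= c2 * (A n + B n).
  rewrite mulrDr /E; have /andP[_ ?] := pc n; have /andP[_ ?] := qc n.
  by rewrite lerD// ler_wpM2r.
have c1D n : 0 <= c1 * D n by rewrite mulr_ge0// ltW.
have Ed m k : (m <= k)%N -> E k <= E m.
  elim: k => [|k IH]; first by rewrite leqn0 => /eqP ->.
  rewrite leq_eqVlt => /predU1P[->//|mk].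
  by rewrite (le_trans _ (IH mk))// (le_trans _ (EH k))// lerDl.
split.
  move=> m k mk; rewrite mulrAC ler_pdivlMr// mulrC.
  by rewrite (le_trans (E1 k))// (le_trans (Ed _ _ mk)).
have cE : cvgn E.
  apply: nonincreasing_is_cvgn; first by move=> m k; exact: Ed.
  exists 0 => _ [n _ <-]; apply: (le_trans _ (E1 n)).
  by rewrite mulr_ge0 ?addr_ge0// ltW.
have dE : (E n - E n.+1) / c1 @[n --> \oo] --> 0.
  rewrite -[X in _ --> X](mul0r c1^-1); apply: cvgMl.
  rewrite -(subrr (limn E)); apply: cvgB => //.
  by rewrite -(cvg_shiftS E) in cE *.
apply: (squeeze_cvgr _ (cvg_cst 0) dE).
by apply: nearW => n; rewrite D0 ler_pdivlMr//= mulrC lerBrDl.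
Qed.

Lemma variable_weight_descent A B D b (bmin bmax : R) :
  0 < bmin -> (forall n, bmin < b n < bmax) ->
  nondecreasing_seq b \/ nonincreasing_seq b ->
  (forall n, 0 <= A n) -> (forall n, 0 <= B n) -> (forall n, 0 <= D n) ->
  (forall n, A n.+1 + B n.+1 / b n + D n <= A n + B n / b n) ->
  (exists2 C, 0 <= C & forall m k, (m <= k)%N -> A k + B k <= C * (A m + B m))
  /\ D @ \oo --> 0.
Proof.
move=> bm0 bb bmon A0 B0 D0 H.
have b0 n : 0 < b n by have /andP[? _] := bb n; exact: lt_trans bm0 _.
have bM0 : 0 < bmax by have /andP[_ ?] := bb 0%N; exact: lt_trans (b0 0%N) _.
(* Common bounds for the three possible weights: 1, [b n] and its inverse. *)
pose c1 := Num.min (Num.min 1 bmax^-1) bmin.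
pose c2 := Num.max (Num.max 1 bmin^-1) bmax.
have c10 : 0 < c1 by rewrite !lt_min ltr01 invr_gt0 bM0 bm0.
have c11 : c1 <= 1 <= c2 by rewrite /c1 /c2 !ge_min !le_max lexx.
have c1b n : c1 <= b n <= c2.
  have /andP[/ltW ? /ltW ?] := bb n.
  by rewrite /c1 /c2 !ge_min !le_max; apply/andP; split; apply/orP; right.
have c1i n : c1 <= (b n)^-1 <= c2.
  have /andP[/ltW ? /ltW ?] := bb n.
  rewrite /c1 /c2 !ge_min !le_max !lef_pV2 ?posrE//.
  by apply/andP; split; apply/orP; left; apply/orP; right.
suff [p [q [pc qc pd qd Hpq]]] : exists p q,
    [/\ forall n, c1 <= p n <= c2, forall n, c1 <= q n <= c2,
      forall n, p n.+1 <= p n, forall n, q n.+1 <= q n &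
      forall n, p n * A n.+1 + q n * B n.+1 + c1 * D n <=
                p n * A n + q n * B n].
  have [HC HD] := weighted_descent c10 pc qc pd qd A0 B0 D0 Hpq.
  split => //; exists (c2 / c1) => //; rewrite divr_ge0// ltW//.
  by have /andP[c11' c12] := c11; rewrite (lt_le_trans ltr01).
case: bmon => [bi|bd].
  exists (cst 1), (fun n => (b n)^-1); split => // [n|n].
    by rewrite lef_pV2 ?posrE// bi.
  rewrite !mul1r mulrC [X in _ <= _ + X]mulrC (le_trans _ (H n))// lerD2l.
  by rewrite ler_piMl//; have /andP[] := c11.
(* For nonincreasing b, multiplying the descent inequality by [b n] moves the varying weight from B
   to A. *)
exists b, (cst 1); split => // [n|n]; first exact: bd.
have := H n; rewrite -(ler_pM2l (b0 n)) !mulrDr.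
rewrite ![b n * (_ / _)]mulrC !divfK ?gt_eqF// !mul1r; apply: le_trans.
by rewrite lerD2l ler_wpM2r//; have /andP[] := c1b n.
Qed.

End weighted_descent.

(** * Step sizes returned by the linesearch *)

Section linesearch_step.
Context {R : realType} {X Y : euclideanType R}.
Variables (K : {linear X -> Y}) (Ks : {linear Y -> X}) (fs : Y -> \bar R).

(** By induction on the run. A rejected t is too large for the bound L on [Ks], which forces c <= mu
    t; hence backtracking never goes below the minimum of the initial trial and c. *)
Lemma linesearch_spec (mu delta b t' : R) (x' x : X) (y : Y) (t s L c : R)
    ynew :
  0 < mu < 1 -> 0 < b -> 0 < t -> 0 < L ->
  (forall v, `|Ks v| <= L * `|v|) ->
  c * (Num.sqrt b * L) <= mu * delta ->
  linesearch K Ks fs mu delta b t' x' x y t s ynew ->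
  [/\ 0 < s, s <= t, Num.min t c <= s, trial K fs b t' x' x y s ynew &
      accepted Ks delta b y s ynew].
Proof.
move=> /andP[mu0 mu1] b0 t0 L0 KsL cL ls;
  elim: ls t0 => [{}t {}ynew tr acc t0|{}t z {}s {}ynew tr rej _ IH t0].
  by split => //; rewrite ge_min lexx.
have [s0 smt mins ? ?] := IH (mulr_gt0 mu0 t0).
have sb0 : 0 < Num.sqrt b by rewrite sqrtr_gt0.
have ct : c <= mu * t.
  rewrite -(ler_pM2r (mulr_gt0 sb0 L0)) (le_trans cL)// -mulrA ler_pM2l//.
  move: rej; rewrite /accepted -ltNge -linearB => rej.
  (* The strict inequality excludes z = y, so |z - y| can be divided out. *)
  have : delta * `|z - y| < t * (Num.sqrt b * L) * `|z - y|.
    apply: (lt_le_trans rej); rewrite (mulrC _ t) -!mulrA !ler_pM2l//.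
  have [->|zy] := eqVneq (`|z - y|) 0; first by rewrite !mulr0 ltxx.
  have zy0 : 0 < `|z - y| by rewrite lt_neqAle eq_sym zy normr_ge0.
  by rewrite ltr_pM2r//; exact: ltW.
split => //.
- by rewrite (le_trans smt)// ler_piMl// ltW.
- by rewrite (le_trans _ mins)// le_min !ge_min ct lexx !orbT.
Qed.

End linesearch_step.

(** * Limits along subsequences *)

Section sequences.
Context {R : realType}.

Lemma cvg_sqr_norm0 (V : normedModType R) (u : nat -> V) (e : nat -> R)
    (c : R) :
  0 < c -> (forall n, c * `|u n| ^+ 2 <= e n) -> e @ \oo --> 0 ->
  u @ \oo --> 0.
Proof.
move=> c0 ue e0; apply/cvgrPdist_lt => r r0.
have cr : 0 < c * r ^+ 2 by rewrite mulr_gt0// exprn_gt0.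
near=> n; rewrite sub0r normrN.
rewrite -(ltr_pXn2r (n := 2))// ?nnegrE ?normr_ge0 ?(ltW r0)//.
rewrite -(ltr_pM2l c0) (le_lt_trans (ue n))//.
by near: n; apply: (cvgr_lt 0).
Unshelve. all: by end_near. Qed.

Lemma subseq_cvgoo (psi : nat -> nat) : (forall n, (n <= psi n)%N) ->
  psi @ \oo --> \oo.
Proof.
move=> le_psi A [N _ NA]; exists N => // n /= Nn.
by apply: NA => /=; exact: leq_trans (le_psi n).
Qed.

Lemma subseq_cvg (T : topologicalType) (psi : nat -> nat) (u : nat -> T)
    (l : T) :
  (forall n, (n <= psi n)%N) -> u @ \oo --> l -> u (psi n) @[n --> \oo] --> l.
Proof. by move=> le_psi; apply: cvg_comp; exact: subseq_cvgoo. Qed.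

(** Pick an index beyond n in the ball of radius 1 / (n + 1). Writing it as a successor leaves room
    for the preceding iterate, which the energy involves. *)
Lemma cluster_subseq (V W : normedModType R) (u : nat -> V) (w : nat -> W) s :
  cluster ((fun k => (u k, w k)) @ \oo) s ->
  exists2 psi, (forall n, (n <= psi n)%N) &
    (u (psi n).+1 @[n --> \oo] --> s.1) /\ (w (psi n).+1 @[n --> \oo] --> s.2).
Proof.
move=> cs.
have H (n : nat) : exists k, [/\ (n <= k)%N, `|u k.+1 - s.1| <= n.+1%:R^-1 &
    `|w k.+1 - s.2| <= n.+1%:R^-1].
  have n0 : 0 < n.+1%:R^-1 :> R by rewrite invr_gt0.
  have [||z [[k nk <-] [/= zu zw]]] :=
      cs [set (u k, w k) | k in [set k | (n < k)%N]]
         (ball s.1 n.+1%:R^-1 `*` ball s.2 n.+1%:R^-1).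
  - by exists n.+1 => // k /= nk; exists k.
  - by exists (ball s.1 n.+1%:R^-1, ball s.2 n.+1%:R^-1) => //;
      split; exact: nbhsx_ballx.
  case: k nk zu zw => // k nk.
  rewrite -!ball_normE/= distrC (distrC s.2) => /ltW ? /ltW ?.
  by exists k.
have [psi psiP] := choice H.
exists psi; first by move=> n; have [] := psiP n.
by split; apply: cvg_norm_le (@cvg_harmonic R) => n; have [] := psiP n.
Qed.

Lemma linear_cvg (X : euclideanType R) (V : normedModType R)
    (f : {linear X -> V}) (u : nat -> X) a :
  u @ \oo --> a -> f (u n) @[n --> \oo] --> f a.
Proof.
move=> ua; have [L _ fL] := linear_bounded_dim f.
apply: (@cvg_norm_le _ _ (fun n => L * `|u n - a|)).
  by move=> n; rewrite -linearB.
rewrite -[X in _ --> X](mulr0 L); apply: cvgMr.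
by apply/norm_cvg0P; apply/subr_cvg0.
Qed.

Lemma bounded_scale_cvg0 (V : normedModType R) (a : nat -> R) (u : nat -> V) M :
  (forall n, `|a n| <= M) -> u @ \oo --> 0 -> a n *: u n @[n --> \oo] --> 0.
Proof.
move=> aM u0; apply: (@cvg_norm_le _ _ (fun n => M * `|u n|)).
  by move=> n; rewrite subr0 normrZ ler_wpM2r.
rewrite -[X in _ --> X](mulr0 M); apply: cvgMr.
exact/norm_cvg0P.
Qed.

End sequences.

(** * Convergence of the iterates *)

Section pdal_convergence.
Context {R : realType} {X Y : euclideanType R}.
Variables (K : {linear X -> Y}) (Ks : {linear Y -> X}).
Variables (g : X -> \bar R) (fs : Y -> \bar R).
Variables (mu delta betamin betamax : R) (beta : nat -> R).
Variables (x : nat -> X) (y : nat -> Y) (tau theta : nat -> R).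
Hypothesis adj : is_adjoint K Ks.
Hypothesis gP : proper_lsc_convex g.
Hypothesis fsP : proper_lsc_convex fs.
Hypothesis betamin_gt0 : 0 < betamin.
Hypothesis beta_bounds : forall k, betamin < beta k.+1 < betamax.
Hypothesis beta_mono : nondecreasing_seq (fun k => beta k.+1) \/
  nonincreasing_seq (fun k => beta k.+1).
Hypothesis run : pdal K Ks g fs mu delta beta x y tau theta.

Let G z := fine (g z).
Let F w := fine (fs w).
Let xbar n := x n.+2 + theta n.+2 *: (x n.+2 - x n.+1).

Lemma beta_gt0 k : 0 < beta k.+1.
Proof. by have /andP[? _] := beta_bounds k; exact: lt_trans betamin_gt0 _. Qed.

(* A step reached by backtracking is mu * t for a rejected t, and rejection forces
   delta < sqrt beta * t * L with L bounding Ks; so every step is at least the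
   minimum of tau 0 and mu * delta / (sqrt betamax * L). *)
Lemma pdal_step : exists2 c : R, 0 < c & forall k,
  [/\ c <= tau k, 0 <= theta k, tau k.+1 <= tau k * Num.sqrt (1 + theta k),
    trial K fs (beta k.+1) (tau k) (x k) (x k.+1) (y k.+1) (tau k.+1) (y k.+2) &
    accepted Ks delta (beta k.+1) (y k.+1) (tau k.+1) (y k.+2)].
Proof.
have [L L0 KsL] := linear_bounded_dim Ks.
have /andP[mu0 _] := pdal_mu run; have /andP[d0 _] := pdal_delta run.
have bM0 : 0 < betamax.
  by have /andP[_ ?] := beta_bounds 0; exact: lt_trans (beta_gt0 0) _.
pose c := mu * delta / (Num.sqrt betamax * L).
have c0 : 0 < c by rewrite divr_gt0 ?mulr_gt0 ?sqrtr_gt0.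
have cb k : c * (Num.sqrt (beta k.+1) * L) <= mu * delta.
  rewrite -ler_pdivlMr ?mulr_gt0 ?sqrtr_gt0 ?beta_gt0// /c.
  rewrite ler_pM2l ?mulr_gt0// lef_pV2 ?posrE ?mulr_gt0 ?sqrtr_gt0 ?beta_gt0//.
  rewrite ler_pM2r// ler_sqrt ?(ltW bM0)//.
  by have /andP[_ /ltW] := beta_bounds k.
have tau0 := pdal_tau0 run.
have base : Num.min (tau 0) c > 0 by rewrite lt_min tau0.
have tauc k : Num.min (tau 0) c <= tau k.
  elim: k => [|k IH]; first by rewrite ge_min lexx.
  have [t [/andP[tt _] ls]] := pdal_linesearch run k.
  have t0 : 0 < t by apply: lt_le_trans tt; exact: lt_le_trans IH.
  have [_ _ + _ _] :=
    linesearch_spec (pdal_mu run) (beta_gt0 k) t0 L0 KsL (cb k) ls.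
  apply: le_trans.
  by rewrite le_min (le_trans IH tt) ge_min lexx orbT.
have tau_gt0 k : 0 < tau k := lt_le_trans base (tauc k).
exists (Num.min (tau 0) c) => // k.
have [t [/andP[tt tr] ls]] := pdal_linesearch run k.
have t0 : 0 < t by apply: lt_le_trans tt.
have [_ st _ ? ?] :=
  linesearch_spec (pdal_mu run) (beta_gt0 k) t0 L0 KsL (cb k) ls.
split => //.
- case: (k) => [|j]; first by rewrite (pdal_theta0 run).
  by rewrite (pdal_theta run) divr_ge0// ltW.
- exact: le_trans tr.
Qed.

Lemma tau_gt0 k : 0 < tau k.
Proof.
by have [c c0 /(_ k)[? _ _ _ _]] := pdal_step; exact: lt_le_trans c0 _.
Qed.

Lemma theta_ge0 k : 0 <= theta k.
Proof. by have [c _ /(_ k)[]] := pdal_step. Qed.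

Lemma thetaM_tau k : theta k.+1 * tau k = tau k.+1.
Proof. by rewrite (pdal_theta run) divfK// gt_eqF// tau_gt0. Qed.

(** This is the upper limit on the trial step, squared and divided by [tau k]. It makes the gap
    terms of consecutive energies telescope. *)
Lemma tauM_theta_le k : tau k.+1 * theta k.+1 <= tau k * (1 + theta k).
Proof.
have [c c0 /(_ k)[_ th0 H _ _]] := pdal_step.
rewrite (pdal_theta run) mulrA ler_pdivrMr ?tau_gt0// -expr2.
have -> : tau k * (1 + theta k) * tau k = (tau k * Num.sqrt (1 + theta k)) ^+ 2.
  by rewrite exprMn sqr_sqrtr ?addr_ge0//; ring.
by rewrite ler_pXn2r// nnegrE ?mulr_ge0 ?sqrtr_ge0// ltW// tau_gt0.
Qed.

Lemma dom_primal k : dom g (x k.+1).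
Proof.
case: gP => gp _ _; apply: prox_dom gp (tau_gt0 k) _.
exact: (pdal_primal run k).
Qed.

Lemma primal_ineq k z : dom g z ->
  tau k * (G (x k.+1) - G z) <=
    '[x k.+1 - (x k - tau k *: Ks (y k.+1)), z - x k.+1].
Proof.
case: gP => gp _ gc; apply: prox_ineq gp gc (tau_gt0 k) _.
exact: (pdal_primal run k).
Qed.

Lemma dual_trial n : let s := beta n.+2 * tau n.+2 in
  prox (fun w => s%:E * fs w)%E (y n.+2 + s *: K (xbar n)) (y n.+3).
Proof.
have [c _ /(_ n.+1)[_ _ _ + _]] := pdal_step.
by rewrite /trial/= -(pdal_theta run).
Qed.

Lemma dual_step_gt0 n : 0 < beta n.+2 * tau n.+2.
Proof. by rewrite mulr_gt0 ?beta_gt0 ?tau_gt0. Qed.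

Lemma dom_dual n : dom fs (y n.+3).
Proof.
by case: fsP => fp _ _; apply: prox_dom fp (dual_step_gt0 n) (dual_trial n).
Qed.

Lemma dual_ineq n w : dom fs w ->
  beta n.+2 * tau n.+2 * (F (y n.+3) - F w) <=
    '[y n.+3 - (y n.+2 + (beta n.+2 * tau n.+2) *: K (xbar n)), w - y n.+3].
Proof.
case: fsP => fp _ fc.
exact: prox_ineq fp fc (dual_step_gt0 n) (dual_trial n).
Qed.


(** * Energy relative to a fixed saddle point *)

Section fixed_saddle.
Variable s : X * Y.
Hypothesis sP : saddle_point K Ks g fs s.

Let P z := G z - G s.1 + '[Ks s.2, z - s.1].
(* The index is shifted by two because [x 0] need not lie in [dom g], so the gap
   is only controlled from [x 1] on. *)
Let A n := `|x n.+2 - s.1| ^+ 2 +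
  2 * (tau n.+1 * (1 + theta n.+1)) * P (x n.+1).
Let B n := `|y n.+2 - s.2| ^+ 2.
Let D n := (1 - delta) * (`|xbar n - x n.+2| ^+ 2 +
  `|x n.+3 - xbar n| ^+ 2 + `|y n.+3 - y n.+2| ^+ 2 / beta n.+2).

Lemma primal_gap_ge0 z : dom g z -> 0 <= P z.
Proof.
case: sP => ds _ + _ dz => /(_ z); case: gP => gp _ _.
by rewrite (proper_fineK gp dz) (proper_fineK gp ds) -EFinB -EFinD lee_fin.
Qed.

Lemma dual_gap_ge0 w : dom fs w -> 0 <= F w - F s.2 - '[K s.1, w - s.2].
Proof.
case: sP => _ ds _ + dw => /(_ w); case: fsP => fp _ _.
by rewrite (proper_fineK fp dw) (proper_fineK fp ds) -!EFinB lee_fin.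
Qed.

Lemma primal_energy_ge n : `|x n.+2 - s.1| ^+ 2 <= A n.
Proof.
rewrite lerDl; apply: mulr_ge0; last exact/primal_gap_ge0/dom_primal.
by rewrite !mulr_ge0 ?addr_ge0 ?theta_ge0 ?(ltW (tau_gt0 _)).
Qed.

Lemma energy_descent n : A n.+1 + B n.+1 / beta n.+2 + D n <=
  A n + B n / beta n.+2.
Proof.
have [ds1 ds2 _ _] := sP; have /andP[d0 _] := pdal_delta run.
have [_ _ /(_ n.+1)[_ _ _ _ acc]] := pdal_step.
have := @descent_step _ _ _ K Ks (x n.+1) (x n.+2) (x n.+3) s.1 (y n.+2)
  (y n.+3) s.2 (tau n.+1) (theta n.+2) (beta n.+2) delta (G (x n.+1))
  (G (x n.+2)) (G (x n.+3)) (G s.1) (F (y n.+3)) (F s.2).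
rewrite thetaM_tau => /(_ adj (theta_ge0 _) (tau_gt0 _) (beta_gt0 _) d0
  (primal_ineq n.+2 ds1) (dual_ineq n ds2)
  (primal_ineq n.+1 (dom_primal n.+2)) _ acc (dual_gap_ge0 (dom_dual n))).
move=> /(_ (primal_ineq n.+1 (dom_primal n))) /le_trans; apply.
(* [descent_step] leaves the old gap with weight 2 tau theta at index n + 2; it remains to compare
   it with the weight in [A n]. *)
rewrite lerD2r lerD2l; apply: ler_wpM2r; first exact/primal_gap_ge0/dom_primal.
by rewrite ler_pM2l//; exact: tauM_theta_le.
Qed.

Lemma energy_controlled :
  (exists2 C, 0 <= C & forall m k, (m <= k)%N -> A k + B k <= C * (A m + B m))
  /\ D @ \oo --> 0.
Proof.
have /andP[_ d1] := pdal_delta run.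
have mono : nondecreasing_seq (fun n => beta n.+2) \/
    nonincreasing_seq (fun n => beta n.+2).
  by case: beta_mono => H; [left|right] => m n mn; apply: H.
apply: (variable_weight_descent betamin_gt0 _ mono _ _ _ energy_descent).
- by move=> n; exact: beta_bounds.
- by move=> n; apply: le_trans (primal_energy_ge n); exact: exprn_ge0.
- by move=> n; exact: exprn_ge0.
- move=> n; rewrite mulr_ge0 ?subr_ge0 ?(ltW d1)// !addr_ge0 ?exprn_ge0//.
  by rewrite divr_ge0 ?exprn_ge0// ltW// beta_gt0.
Qed.

Lemma increments_cvg0 :
  [/\ xbar n - x n.+2 @[n --> \oo] --> 0,
      x n.+3 - xbar n @[n --> \oo] --> 0 &
      y n.+3 - y n.+2 @[n --> \oo] --> 0].
Proof.
have [_ D0] := energy_controlled.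
have /andP[_ d1] := pdal_delta run; rewrite -subr_gt0 in d1.
have yb n : 0 <= `|y n.+3 - y n.+2| ^+ 2 / beta n.+2.
  by rewrite divr_ge0 ?exprn_ge0// ltW// beta_gt0.
have bM : 0 < betamax.
  by have /andP[_ ?] := beta_bounds 0; exact: lt_trans (beta_gt0 0) _.
have Dge n : [/\ (1 - delta) * `|xbar n - x n.+2| ^+ 2 <= D n,
    (1 - delta) * `|x n.+3 - xbar n| ^+ 2 <= D n &
    (1 - delta) / betamax * `|y n.+3 - y n.+2| ^+ 2 <= D n].
  have yM : betamax^-1 * `|y n.+3 - y n.+2| ^+ 2 <=
      `|y n.+3 - y n.+2| ^+ 2 / beta n.+2.
    rewrite mulrC ler_wpM2l ?exprn_ge0// lef_pV2 ?posrE ?beta_gt0//.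
    by have /andP[_ /ltW] := beta_bounds n.+1.
  have := sqr_ge0 `|xbar n - x n.+2|; have := sqr_ge0 `|x n.+3 - xbar n|.
  by move=> ? ?; rewrite /D -mulrA !ler_pM2l//; split; move: (yb n) yM; lra.
split.
- by apply: (cvg_sqr_norm0 d1 _ D0) => n; have [] := Dge n.
- by apply: (cvg_sqr_norm0 d1 _ D0) => n; have [] := Dge n.
- apply: (cvg_sqr_norm0 (divr_gt0 d1 bM) _ D0) => n.
  by have [] := Dge n.
Qed.

Lemma iterates_bounded : exists M, forall k, `|x k.+1| <= M /\ `|y k.+1| <= M.
Proof.
have [[C C0 HC] _] := energy_controlled.
pose E := Num.sqrt (C * (A 0 + B 0)).
have H k : `|x k.+2 - s.1| <= E /\ `|y k.+2 - s.2| <= E.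
  have Ak := primal_energy_ge k; have Bk : 0 <= B k by exact: exprn_ge0.
  have A0 : 0 <= A k by apply: le_trans Ak; exact: exprn_ge0.
  have := HC 0%N k (leq0n k).
  move=> AB; have E2 : E ^+ 2 = C * (A 0%N + B 0%N).
    by rewrite sqr_sqrtr// (le_trans _ AB)// addr_ge0.
  have E0 : 0 <= E by exact: sqrtr_ge0.
  split; rewrite -(ler_pXn2r (n := 2)) ?nnegrE ?normr_ge0// E2.
  - by apply: le_trans AB; rewrite (le_trans Ak)// lerDl.
  - by apply: le_trans AB; rewrite -[leLHS]/(B k) lerDr.
(* The energy controls iterates from index 2 on; those of index 1 are added by hand. *)
exists (`|x 1| + `|s.1| + E + (`|y 1| + `|s.2| + E)) => -[|k].
  have E0 : 0 <= E by exact: sqrtr_ge0.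
  have := normr_ge0 (x 1); have := normr_ge0 (y 1).
  by have := normr_ge0 s.1; have := normr_ge0 s.2; split; lra.
have [Hx Hy] := H k.
have := normr_ge0 (x 1); have := normr_ge0 (y 1).
have := normr_ge0 s.1; have := normr_ge0 s.2.
have := normr_ge0 (x k.+2 - s.1); have := normr_ge0 (y k.+2 - s.2).
have := ler_normD (x k.+2 - s.1) s.1; have := ler_normD (y k.+2 - s.2) s.2.
by rewrite !subrK; split; lra.
Qed.

End fixed_saddle.

Hypothesis saddle_ex : exists s, saddle_point K Ks g fs s.

(** * Cluster points are saddle points *)

Section cluster_point.
Variables (psi : nat -> nat) (s : X * Y).
Hypothesis le_psi : forall n, (n <= psi n)%N.
Hypothesis x_psi : x (psi n).+2 @[n --> \oo] --> s.1.
Hypothesis y_psi : y (psi n).+2 @[n --> \oo] --> s.2.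

Lemma tau_inv_bounded : exists M, forall k, `|(tau k)^-1| <= M.
Proof.
have [c c0 tauc] := pdal_step; exists c^-1 => k.
have t0 := tau_gt0 k; rewrite gtr0_norm ?invr_gt0// lef_pV2 ?posrE//.
by have [] := tauc k.
Qed.

Lemma cluster_primal z : dom g z ->
  (g s.1 <= (G z + '[Ks s.2, z - s.1])%:E)%E.
Proof.
move=> dz; have [s0 /increments_cvg0[dx _ _]] := saddle_ex.
have [M tauM] := tau_inv_bounded.
(* This equals the increment of x divided by its step, the term left in the prox inequality after
   division by tau. Passing through xbar, whose increment is known to vanish, shows that it tends to
   0. *)
pose v n := (tau n.+2)^-1 *: (xbar n - x n.+2).
have v0 : v @ \oo --> 0.
  by apply: bounded_scale_cvg0 dx => n; exact: tauM.
have vE n : v n = (tau n.+1)^-1 *: (x n.+2 - x n.+1).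
  rewrite /v /xbar addrAC subrr add0r scalerA; congr (_ *: _).
  rewrite -(thetaM_tau n.+1) invfM mulrAC mulVf ?mul1r// gt_eqF//.
  by rewrite (pdal_theta run) divr_gt0// tau_gt0.
have [gp gl _] := gP.
apply: (lsc_cvg_le (r := fun n => G z +
  '[v (psi n) + Ks (y (psi n).+2), z - x (psi n).+2]) gl x_psi).
  apply: cvgD; first exact: cvg_cst.
  rewrite -[Ks s.2]add0r; apply: dotp_cvg.
    by apply: cvgD; [exact: subseq_cvg le_psi v0|exact: linear_cvg].
  by apply: cvgB => //; exact: cvg_cst.
move=> n; rewrite (proper_fineK gp (dom_primal _)) lee_fin -lerBlDl.
have t0 := tau_gt0 (psi n).+1; rewrite -(ler_pM2l t0).
apply: (le_trans (primal_ineq (psi n).+1 dz)).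
rewrite -dotpZl scalerDr vE scalerA mulfV ?gt_eqF// scale1r opprB.
by rewrite addrCA [X in '[X, _]]addrC.
Qed.

(** As on the primal side, with beta tau bounded away from 0. Vanishing increments transfer the
    limits to [xbar (psi n)] and [y (psi n).+3]. *)
Lemma cluster_dual w : dom fs w ->
  (fs s.2 <= (F w - '[K s.1, w - s.2])%:E)%E.
Proof.
move=> dw; have [s0 /increments_cvg0[dx _ dy]] := saddle_ex.
have [M tauM] := tau_inv_bounded.
pose v n := (beta n.+2 * tau n.+2)^-1 *: (y n.+3 - y n.+2).
have v0 : v @ \oo --> 0.
  apply: (bounded_scale_cvg0 (M := betamin^-1 * M)) dy => n.
  rewrite invfM normrM ler_pM// gtr0_norm ?invr_gt0 ?beta_gt0//.
  rewrite lef_pV2 ?posrE ?beta_gt0//.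
  by have /andP[/ltW] := beta_bounds n.+1.
have xb : xbar (psi n) @[n --> \oo] --> s.1.
  exact: cvg_sub0 (subseq_cvg le_psi dx) x_psi.
have y3 : y (psi n).+3 @[n --> \oo] --> s.2.
  exact: cvg_sub0 (subseq_cvg le_psi dy) y_psi.
have [fp fl _] := fsP.
apply: (lsc_cvg_le (r := fun n => F w +
  '[v (psi n) - K (xbar (psi n)), w - y (psi n).+3]) fl y3).
  apply: cvgD; first exact: cvg_cst.
  rewrite -dotpNl -[- K s.1]add0r; apply: dotp_cvg.
    by apply: cvgB; [exact: subseq_cvg le_psi v0|exact: linear_cvg].
  by apply: cvgB => //; exact: cvg_cst.
move=> n; rewrite (proper_fineK fp (dom_dual _)) lee_fin -lerBlDl.
have t0 := dual_step_gt0 (psi n); rewrite -(ler_pM2l t0).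
apply: (le_trans (dual_ineq (psi n) dw)).
rewrite -dotpZl scalerBr scalerA mulfV ?gt_eqF// scale1r.
by rewrite opprD addrA.
Qed.

Lemma cluster_saddle : saddle_point K Ks g fs s.
Proof.
have [[_ [z0 dz0]] _ _] := gP; have [[_ [w0 dw0]] _ _] := fsP.
(* A single point of each domain bounds the value at the cluster point by a real number. *)
have dg : dom g s.1 by apply: le_lt_trans (cluster_primal dz0) _; rewrite ltry.
have df : dom fs s.2 by apply: le_lt_trans (cluster_dual dw0) _; rewrite ltry.
have [gp _ _] := gP; have [fp _ _] := fsP.
split => // [z|w].
- have [->|zy] := eqVneq (g z) +oo%E.
    by rewrite (proper_fineK gp dg) -EFinN !addye ?leey.
  have dz : dom g z by rewrite /dom/= ltey.
  have := cluster_primal dz; rewrite (proper_fineK gp dg) (proper_fineK gp dz).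
  by rewrite -EFinB -EFinD !lee_fin -/(G z); lra.
- have [->|wy] := eqVneq (fs w) +oo%E.
    by rewrite (proper_fineK fp df) -!EFinN !addye ?leey.
  have dw : dom fs w by rewrite /dom/= ltey.
  have := cluster_dual dw; rewrite (proper_fineK fp df) (proper_fineK fp dw).
  by rewrite -!EFinB !lee_fin -/(F w); lra.
Qed.

(** * Convergence of the whole sequence *)

Hypothesis g_cont : {within dom g, continuous g}.
Hypothesis tau_ub : has_ubound (range tau).

(** With the cluster point itself as reference saddle point, the energy tends to 0 along [psi], and
    [energy_controlled] carries its smallness to all later indices. *)
Lemma whole_sequence_cvg :
  x n.+2 @[n --> \oo] --> s.1 /\ y n.+2 @[n --> \oo] --> s.2.
Proof.
have sP := cluster_saddle.
have [[C C0 HC] _] := energy_controlled sP.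
have [dx _ _] := increments_cvg0 sP.
have [ds _ _ _] := sP; have [gp _ _] := gP.
have [T tauT] : exists T, forall k, tau k <= T.
  by have [T HT] := tau_ub; exists T => k; apply: HT; exists k.
have [M tauM] := tau_inv_bounded.
have T0 : 0 <= T by apply: le_trans (tauT 0%N); rewrite ltW// tau_gt0.
(* The increment of x is that of xbar divided by theta; the upper bound on tau, with the lower one,
   bounds 1 / theta. *)
have x1 : x (psi n).+1 @[n --> \oo] --> s.1.
  suff d0 : x n.+1 - x n.+2 @[n --> \oo] --> 0.
    exact: cvg_sub0 (subseq_cvg le_psi d0) x_psi.
  have -> : (fun n => x n.+1 - x n.+2) =
      fun n => (- tau n.+1 / tau n.+2) *: (xbar n - x n.+2).
    apply/funext => n; rewrite /xbar addrAC subrr add0r scalerA.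
    rewrite -(thetaM_tau n.+1) (_ : _ * _ = -1) ?scaleN1r ?opprB//.
    field; by rewrite (pdal_theta run) mulf_neq0 ?invr_eq0 ?gt_eqF ?tau_gt0.
  apply: (@bounded_scale_cvg0 _ _ (fun n => - tau n.+1 / tau n.+2) _ (T * M))
    dx.
  by move=> n; rewrite normrM normrN ler_pM// gtr0_norm// tau_gt0.
(* Continuity within the domain suffices, since these iterates lie in [dom g]. *)
have gap0 : G (x (psi n).+1) @[n --> \oo] --> G s.1.
  apply: fine_cvg; rewrite -(proper_fineK gp ds).
  have : g @ within (dom g) (nbhs s.1) --> g s.1.
    have := @g_cont s.1.
    by rewrite /continuous_at /nbhs/= nbhs_subspace_in.
  apply: cvg_comp => B; rewrite /within/= => /x1 [N _ NB].
  by exists N => // n Nn; apply: NB => //; exact: dom_primal.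
pose W n := 2 * (tau (psi n).+1 * (1 + theta (psi n).+1)).
pose P z := G z - G s.1 + '[Ks s.2, z - s.1].
have P0 : P (x (psi n).+1) @[n --> \oo] --> 0.
  have -> : (0 : R) = G s.1 - G s.1 + '[Ks s.2, s.1 - s.1].
    by rewrite !subrr dotpC dotp0l addr0.
  apply: cvgD; first by apply: cvgB => //; exact: cvg_cst.
  by apply: dotp_cvg; [exact: cvg_cst|apply: cvgB => //; exact: cvg_cst].
have W0 : W n * P (x (psi n).+1) @[n --> \oo] --> 0.
  apply: (@bounded_scale_cvg0 _ R^o W _ (2 * (T * (1 + T * M)))) P0 => n.
  have th : theta (psi n).+1 <= T * M.
    rewrite (pdal_theta run); apply: ler_pM.
    all: rewrite ?invr_ge0 ?(ltW (tau_gt0 _))//.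
    exact: le_trans (ler_norm _) (tauM _).
  have th1 : 0 <= 1 + theta (psi n).+1 by rewrite addr_ge0// theta_ge0.
  have ? := ltW (tau_gt0 (psi n).+1).
  rewrite ger0_norm ?ler_pM2l//; last by rewrite !mulr_ge0.
  by apply: ler_pM; rewrite ?lerD2l.
have E0 : `|x (psi n).+2 - s.1| ^+ 2 + W n * P (x (psi n).+1)
     + `|y (psi n).+2 - s.2| ^+ 2 @[n --> \oo] --> 0.
  have -> : (0 : R) = `|s.1 - s.1| * `|s.1 - s.1| + 0
      + `|s.2 - s.2| * `|s.2 - s.2|.
    by rewrite !subrr !normr0 !mul0r !addr0.
  have nx : `|x (psi n).+2 - s.1| @[n --> \oo] --> `|s.1 - s.1|.
    by apply: cvg_norm; apply: cvgB => //; exact: cvg_cst.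
  have ny : `|y (psi n).+2 - s.2| @[n --> \oo] --> `|s.2 - s.2|.
    by apply: cvg_norm; apply: cvgB => //; exact: cvg_cst.
  by apply: cvgD; [apply: cvgD => //; exact: cvgM|exact: cvgM].
have small e : 0 < e -> exists N, forall k, (N <= k)%N ->
    `|x k.+2 - s.1| ^+ 2 + `|y k.+2 - s.2| ^+ 2 <= e.
  (* C is only known to be nonnegative, hence the divisor C + 1. *)
  move=> e0; have Ce0 : 0 < e / (C + 1) by rewrite divr_gt0// ltr_pwDr.
  have [n _ /(_ n (leqnn n)) /= En] := cvgr_lt _ E0 _ Ce0.
  exists (psi n) => k nk.
  apply: le_trans (lerD (primal_energy_ge sP k) (lexx _)) _.
  apply: (le_trans (HC _ _ nk)).
  have := ltW En; rewrite ler_pdivlMr ?ltr_pwDr// mulrC => /(le_trans _); apply.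
  rewrite ler_wpM2r ?lerDl// addr_ge0 ?exprn_ge0//.
  by apply: le_trans (primal_energy_ge sP _); exact: exprn_ge0.
have lim (V : normedModType R) (u : nat -> V) l :
    (forall e : R, 0 < e -> exists N, forall k, (N <= k)%N ->
      `|u k - l| ^+ 2 <= e) -> u @ \oo --> l.
  move=> H; apply/cvgrPdist_le => e e0.
  have [N HN] := H (e ^+ 2) (exprn_gt0 _ e0).
  exists N => // k /= /HN; rewrite distrC.
  by rewrite ler_pXn2r// nnegrE// ltW.
split; apply: lim => e /small[N HN]; exists N => k /HN; apply: le_trans.
- by rewrite lerDl exprn_ge0.
- by rewrite lerDr exprn_ge0.
Qed.

End cluster_point.

End pdal_convergence.

(** * Boundedness, cluster points and convergence assembled for the pairs of iterates *)

Theorem theorem3 (R : realType) (X Y : euclideanType R)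
    (K : {linear X -> Y}) (Ks : {linear Y -> X})
    (g : X -> \bar R) (f : Y -> \bar R)
    (mu delta betamin betamax : R) (beta : nat -> R)
    (x : nat -> X) (y : nat -> Y) (tau theta : nat -> R) :
  is_adjoint K Ks ->
  proper_lsc_convex g ->
  lower_semicontinuous f -> econvex f ->
  proper_lsc_convex (conjugate f) ->
  (exists s, saddle_point K Ks g (conjugate f) s) ->
  0 < betamin -> 0 < betamax ->
  (forall k, betamin < beta k.+1 < betamax) ->
  nondecreasing_seq (fun k => beta k.+1) \/
    nonincreasing_seq (fun k => beta k.+1) ->
  pdal K Ks g (conjugate f) mu delta beta x y tau theta ->
  let z : nat -> X * Y := fun k => (x k.+1, y k.+1) in
  [/\ bounded_set (range z),
      cluster (z @ \oo) `<=` [set s | saddle_point K Ks g (conjugate f) s] &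
      {within dom g, continuous g} -> has_ubound (range tau) ->
      exists2 s, saddle_point K Ks g (conjugate f) s & z @ \oo --> s].
Proof.
move=> adj gP _ _ fP sex bm0 _ bb bmono run z.
have [s0 s0P] := sex.
have [M HM] := iterates_bounded adj gP fP bm0 bb bmono run s0P.
have xM k : `|x k.+1| <= M by have [] := HM k.
have yM k : `|y k.+1| <= M by have [] := HM k.
have cluster_sub s : cluster (z @ \oo) s -> exists psi,
    [/\ forall n, (n <= psi n)%N, x (psi n).+2 @[n --> \oo] --> s.1 &
      y (psi n).+2 @[n --> \oo] --> s.2].
  by case/cluster_subseq => psi le_psi [xs ys]; exists psi.
split.
- exists M; split; first exact: num_real.
  move=> N /ltW MN _ [k _ <-]; rewrite /z.
  rewrite /= prod_normE/= ge_max.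
  by rewrite !(le_trans _ MN).
- move=> s /cluster_sub[psi [le_psi xs ys]].
  exact (cluster_saddle adj gP fP bm0 bb bmono run sex le_psi xs ys).
- move=> gc tb; have [s cs] := bounded_seq_cluster xM yM.
  have [psi [le_psi xs ys]] := cluster_sub _ cs.
  exists s.
    exact (cluster_saddle adj gP fP bm0 bb bmono run sex le_psi xs ys).
  have [cx cy] :=
    whole_sequence_cvg adj gP fP bm0 bb bmono run sex le_psi xs ys gc tb.
  apply: (@cvg_trans _ ((x k.+1, y k.+1) @[k --> \oo])) => //.
  rewrite [s]surjective_pairing; apply: cvg_pair.
    by rewrite -(cvg_shiftS (fun n => x n.+1)).
  by rewrite -(cvg_shiftS (fun n => y n.+1)).
Qed.
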